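(* Let $m\geq 2$ and $n\geq 4m+2$ be integers, let $S=\{0,1,\dots,m\}$, let $G=J_S(n,2m+1)$, and let $C$ be the set of $(2m+1)$-subsets of $\{1,\dots,2m+2\}$ (a switching set of $G$). If $CM$ is the graph obtained from $G$ by Godsil–McKay switching with respect to $C$, then $G$ and $CM$ are not isomorphic.
   Context: For integers $n\geq k\geq 2$ and $S\subseteq\{0,1,\dots,k-1\}$, $J_S(n,k)$ is the graph whose vertices are the $k$-subsets of $[n]=\{1,\dots,n\}$, two $k$-subsets $A,B$ being adjacent if $|A\cap B|\in S$. A subset $C$ of the vertex set of a graph $G$ is a switching set if any two vertices of $C$ have the same number of neighbours in $C$ and every vertex outside $C$ is adjacent to $0$, $|C|/2$ or $|C|$ vertices of $C$. Godsil–McKay switching with respect to $C$: for every vertex $u\notin C$ adjacent to exactly $|C|/2$ vertices of $C$, delete the $|C|/2$ edges between $u$ and $C$ and join $u$ to the other $|C|/2$ vertices of $C$; all other adjacencies are unchanged. *)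

(* Defs.v *)
From mathcomp Require Import all_boot.
Set Implicit Arguments.
Unset Strict Implicit.
Unset Printing Implicit Defensive.

Record sgraph := SGraph {
  vertex :> finType;
  adj : rel vertex;
  adj_sym : symmetric adj;
  adj_irrefl : irreflexive adj
}.

Arguments adj : clear implicits.

Definition isomorphic (G H : sgraph) : Prop :=
  exists f : G -> H,
    bijective f /\ forall x y : G, adj H (f x) (f y) = adj G x y.

(* The ground set [n] = {1, ..., n} is 'I_n, with i : 'I_n standing for i + 1. *)
Definition ksubset (n k : nat) : finType := {A : {set 'I_n} | #|A| == k}.

(* A subset of {0, ..., k - 1} is an S : {set 'I_k}. *)
Definition J_adj (n k : nat) (S : {set 'I_k}) : rel (ksubset n k) :=
  fun A B => [exists s in S, #|val A :&: val B| == s :> nat].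

Lemma J_adj_sym (n k : nat) (S : {set 'I_k}) : symmetric (@J_adj n k S).
Proof. by move=> A B; rewrite /J_adj setIC. Qed.

Lemma J_adj_irrefl (n k : nat) (S : {set 'I_k}) : irreflexive (@J_adj n k S).
Proof.
move=> A; apply/negbTE/negP => /existsP[s /andP[_]].
by rewrite setIid (eqP (valP A)) => /eqP ks; have := ltn_ord s; rewrite -ks ltnn.
Qed.

Definition J (n k : nat) (S : {set 'I_k}) : sgraph :=
  SGraph (@J_adj_sym n k S) (@J_adj_irrefl n k S).

Section GodsilMcKay.

Variables (G : sgraph) (C : {set G}).

Definition nb_in (u : G) : nat := #|[set v in C | adj G u v]|.

(* Stated by doubling: half of an odd #|C| is never attained. *)
Definition half_adjacent (u : G) : bool := (nb_in u).*2 == #|C|.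

Definition switching_set : Prop :=
  (forall x y : G, x \in C -> y \in C -> nb_in x = nb_in y) /\
  (forall u : G, u \notin C ->
     [\/ nb_in u = 0, half_adjacent u | nb_in u = #|C|]).

Definition switched (u v : G) : bool :=
  [&& u \notin C, v \in C & half_adjacent u].

Definition gm_adj : rel G :=
  fun u v => if switched u v || switched v u then ~~ adj G u v else adj G u v.

Lemma gm_adj_sym : symmetric gm_adj.
Proof. by move=> u v; rewrite /gm_adj orbC (adj_sym u). Qed.

Lemma gm_adj_irrefl : irreflexive gm_adj.
Proof.
by move=> u; rewrite /gm_adj /switched; case: (u \in C); exact: adj_irrefl.
Qed.

Definition gm_switch : sgraph := SGraph gm_adj_sym gm_adj_irrefl.

End GodsilMcKay.

(* Main.v *)
(** Assign to a pair of distinct non-adjacent vertices its number of common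
    neighbours. In [J_S(n, 2m+1)] this number is a strictly increasing function
    of the size, at least [m], of the intersection. Let [L] be its value at
    [2m] and consider the pairs of distinct non-adjacent vertices with at least
    [L] common neighbours. Switching creates no such pair: common
    neighbourhoods of two vertices outside [C] keep their size, pairs inside
    [C] qualified already, and a pair between [C] and its complement never
    qualifies in the switched graph, whereas those meeting in [2m] points
    qualified before. So the switched graph has strictly fewer such pairs. *)
Require Import Defs.
From mathcomp Require Import all_boot fingroup perm zify.
Set Implicit Arguments.
Unset Strict Implicit.
Unset Printing Implicit Defensive.

(** * Close pairs as an isomorphism invariant *)

Definition common_nb (G : sgraph) (x y : G) : nat :=
  #|[set u | adj G x u && adj G y u]|.

(** The pairs are ordered, so each unordered pair counts twice, in every graph alike. *)
Definition close_pairs (G : sgraph) (L : nat) : {set G * G} :=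
  [set p | [&& p.1 != p.2, ~~ adj G p.1 p.2 & L <= common_nb p.1 p.2]].

Lemma close_pairsP (G : sgraph) (L : nat) (x y : G) :
  reflect [/\ x != y, ~~ adj G x y & L <= common_nb x y] ((x, y) \in close_pairs G L).
Proof. by rewrite inE; apply: and3P. Qed.

Lemma common_nbC (G : sgraph) (x y : G) : common_nb x y = common_nb y x.
Proof. by congr #|pred_of_set _|; apply/setP=> u; rewrite !inE andbC. Qed.

Lemma card_close_pairs_iso (G H : sgraph) (L : nat) :
  isomorphic G H -> #|close_pairs G L| = #|close_pairs H L|.
Proof.
case=> f [[g fK gK] adjf]; have f_inj := can_inj fK.
have nbf x y : common_nb (f x) (f y) = common_nb x y.
  rewrite /common_nb -[RHS](card_imset _ f_inj); apply: eq_card => u.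
  by rewrite -[u]gK mem_imset // !inE !adjf.
pose ff p := (f p.1, f p.2).
have ff_inj : injective ff by case=> a b [c d] [/f_inj-> /f_inj->].
rewrite -(card_imset _ ff_inj); apply: eq_card => -[a b].
rewrite -[a]gK -[b]gK -/(ff (g a, g b)) mem_imset // !inE /=.
by rewrite adjf nbf (inj_eq f_inj).
Qed.

(** * Common neighbours under Godsil-McKay switching *)

Section Switching.

Variables (G : sgraph) (C : {set G}).
Hypothesis swC : switching_set C.

Let CM := gm_switch C.

Lemma gm_adj_out (x y : G) : x \notin C -> y \notin C -> adj CM x y = adj G x y.
Proof. by rewrite /= /gm_adj /switched => /negbTE-> /negbTE->; rewrite !andbF. Qed.

Lemma gm_adj_in (x y : G) : x \in C -> y \in C -> adj CM x y = adj G x y.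
Proof. by rewrite /= /gm_adj /switched => -> ->. Qed.

Lemma gm_adj_mixed (x y : G) : x \in C -> y \notin C ->
  adj CM x y = half_adjacent C y (+) adj G x y.
Proof.
rewrite /= /gm_adj /switched => -> -> /=.
by case: half_adjacent; case: adj.
Qed.

Lemma nb_in0P (u c : G) : nb_in C u = 0 -> c \in C -> adj G u c = false.
Proof.
by move=> /eqP/[!cards_eq0]/eqP/setP/(_ c); rewrite !inE => + cC; rewrite cC.
Qed.

Lemma nb_in_fullP (u c : G) : nb_in C u = #|C| -> c \in C -> adj G u c.
Proof.
move=> full cC; have /eqP/setP/(_ c) : [set v in C | adj G u v] == C.
  by rewrite eqEcard -full leqnn andbT; apply/subsetP=> v /[!inE]/andP[].
by rewrite !inE cC.
Qed.

Lemma common_nb_split (H : sgraph) (A : {set H}) (x y : H) :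
  common_nb x y = #|[set u in A | adj H x u && adj H y u]|
                  + #|[set u in ~: A | adj H x u && adj H y u]|.
Proof.
rewrite /common_nb -[LHS](cardsID A); congr (_ + _); apply: eq_card => u.
  by rewrite !inE andbC.
by rewrite !inE.
Qed.

(** Only common neighbours inside [C] can change. Switching replaces the trace [N z] on [C] of a
    half-adjacent [z] by its complement in [C]; every other trace is empty or all of [C]. Two
    subsets of size [#|C| / 2] meet in as many points as their complements do, and such a subset
    meets the empty set, or [C], in as many points as its complement. *)
Lemma common_nb_gm_out (x y : G) : x \notin C -> y \notin C ->
  @common_nb CM x y = common_nb x y.
Proof.
move=> xC yC; rewrite (@common_nb_split CM C) (common_nb_split C); congr (_ + _); last first.
  apply: eq_card => u; rewrite !inE.
  by case: (boolP (u \in C)) => [//|uC]; rewrite !gm_adj_out.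
have adjE (z u : G) : z \notin C -> u \in C ->
    adj CM z u = half_adjacent C z (+) adj G z u.
  by move=> zC uC; rewrite [LHS](@adj_sym CM) gm_adj_mixed // [adj G u z]adj_sym.
pose N (z : G) := [set v in C | adj G z v].
have NE (H : rel G) : [set u in C | H x u && H y u]
    = [set u in C | H x u] :&: [set u in C | H y u].
  by apply/setP=> u; rewrite !inE; case: (u \in C).
rewrite (NE (adj CM)) (NE (adj G)) -/(N x) -/(N y).
have N'E z : z \notin C ->
    [set u in C | adj CM z u] = if half_adjacent C z then C :\: N z else N z.
  move=> zC; apply/setP=> u; case: ifP => hz; rewrite !inE;
    by case: (boolP (u \in C)) => [uC|//]; rewrite adjE // hz ?addTb ?andbT.
rewrite !N'E //.
have NC z : N z \subset C by apply/subsetP=> v /[!inE]/andP[].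
have cardN z : #|N z| = nb_in C z by [].
have half z : half_adjacent C z -> #|C| = (nb_in C z).*2 by move/eqP.
have cardD z : half_adjacent C z -> #|C :\: N z| = #|N z|.
  by move=> /half; rewrite cardsD (setIidPr (NC z)) cardN => ->; lia.
have unh z : z \notin C -> ~~ half_adjacent C z -> N z = set0 \/ N z = C.
  move=> zC hz; case: (swC.2 z zC) => [h|h|h]; last 1 first.
  - by right; apply/eqP; rewrite eqEcard NC cardN h leqnn.
  - by left; apply/eqP; rewrite -cards_eq0 cardN h.
  - by rewrite h in hz.
case: ifP => hx; case: ifP => hy //.
- rewrite -setDUr cardsD (setIidPr _) ?subUset ?NC // cardsU !cardN.
  have := half _ hx; have := half _ hy.
  have: #|N x :&: N y| <= #|N x| by rewrite subset_leq_card ?subsetIl.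
  rewrite cardN; move: (nb_in C x) (nb_in C y) #|C| #|N x :&: N y| => p q r s; lia.
- case: (unh y yC (negbT hy)) => ->; first by rewrite !setI0.
  by rewrite !(setIidPl _) ?subsetDl ?NC // cardD.
- case: (unh x xC (negbT hx)) => ->; first by rewrite !set0I.
  by rewrite !(setIidPr _) ?subsetDl ?NC // cardD.
Qed.

(* The switched graph is [Q A Q] for the reflection [Q = (2 / #|C|) J - I] on
   [C]; this is the mixed block of [Q A^2 Q]. *)
Lemma common_nb_gm_mixed (c w : G) :
  (forall x, x \in C -> nb_in C x = 0) -> c \in C -> w \notin C ->
  #|C| * (@common_nb CM c w + common_nb c w)
  = 2 * \sum_(x in C) common_nb x w.
Proof.
move=> C0 cC wC.
(* Double counting of the pairs of [x] in [C] and a common neighbour [u] of [x] and [w]. *)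
have -> : \sum_(x in C) common_nb x w = \sum_u adj G w u * nb_in C u.
  under eq_bigr => x _ do rewrite /common_nb -sum1_card big_mkcond /=.
  rewrite exchange_big /=; apply: eq_bigr => u _.
  rewrite /nb_in -sum1_card big_distrr /= [LHS]big_mkcond [RHS]big_mkcond.
  apply: eq_bigr => x _; rewrite !inE (adj_sym x).
  by case: (x \in C); case: (adj G u x); case: (adj G w u).
(* Hiding the factor [#|C|] as [q] keeps it from being turned into a sum with the other
   cardinals. *)
move eq: {1}#|C| => q.
rewrite /common_nb -!sum1_card ![\sum_(_ in _) 1]big_mkcond -big_split /= !big_distrr /=.
apply: eq_bigr => u _; rewrite !inE; change (gm_adj C) with (adj CM).
(* The identity holds for each [u] separately. Inside [C] both sides vanish. For [u] outside [C] and
   adjacent to [w], the adjacencies of [c] and [u] before and after switching add up to 0, 1 or 2,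
   according as [u] sees none, half or all of [C]. *)
have [uC|uC] := boolP (u \in C).
  by rewrite gm_adj_in // C0 // adj_sym (nb_in0P (C0 _ uC)) //= addn0 !muln0.
rewrite gm_adj_mixed // gm_adj_out //; case: (adj G w u); last by rewrite !andbF !muln0.
rewrite !andbT mul1n; case: (boolP (half_adjacent C u)) => [hu|hu].
  by move/eqP: hu; rewrite eq; case: adj => /=; lia.
case: (swC.2 u uC) => [h|h|h]; last 1 first.
- by rewrite (adj_sym c) (nb_in_fullP h) //= h eq; lia.
- by rewrite (adj_sym c) (nb_in0P h) //= h; lia.
- by rewrite h in hu.
Qed.

End Switching.

(** * Pairs of subsets up to permutation of the ground set *)

(** Colour each point by its membership in the two sets. The three cardinals determine the sizes of
    the four colour classes, so the two colourings are rearrangements of each other. *)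
Lemma perm_pair_of_sets (n : nat) (A B A' B' : {set 'I_n}) :
  #|A| = #|A'| -> #|B| = #|B'| -> #|A :&: B| = #|A' :&: B'| ->
  exists p : 'S_n, forall x, (p x \in A') = (x \in A) /\ (p x \in B') = (x \in B).
Proof.
move=> eA eB eAB.
pose col (X Y : {set 'I_n}) := [tuple (x \in X, x \in Y) | x < n].
have cnt (X Y : {set 'I_n}) c : count_mem c (col X Y) =
    match c with
    | (true, true) => #|X :&: Y|
    | (true, false) => #|X| - #|X :&: Y|
    | (false, true) => #|Y| - #|X :&: Y|
    | (false, false) => n - (#|X| + #|Y| - #|X :&: Y|)
    end.
  have -> : count_mem c (col X Y) = #|[set x | (x \in X, x \in Y) == c]|.
    rewrite /= count_map cardsE cardE -size_filter; congr size.
    by rewrite /enum_mem filter_predT; apply: eq_filter => x.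
  case: c => [] [] [].
  - by apply: eq_card => x; rewrite !inE xpair_eqE !eqb_id.
  - rewrite -cardsD; apply: eq_card => x; rewrite !inE xpair_eqE.
    by case: (x \in X); case: (x \in Y).
  - rewrite setIC -cardsD; apply: eq_card => x; rewrite !inE xpair_eqE.
    by case: (x \in X); case: (x \in Y).
  - rewrite -cardsU cardsCs card_ord; congr (n - _).
    apply: eq_card => x; rewrite !inE xpair_eqE.
    by case: (x \in X); case: (x \in Y).
have /tuple_permP[p pP] : perm_eq (col A B) (col A' B').
  by apply/allP=> c _ /=; rewrite !cnt eA eB eAB.
exists p => x; have := congr1 (fun s => nth (false, false) s x) pP.
by rewrite -!tnth_nth !tnth_mktuple => -[-> ->].
Qed.

Lemma exists_subset_card (T : finType) (D : {set T}) (k : nat) :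
  k <= #|D| -> exists2 E : {set T}, E \subset D & #|E| = k.
Proof.
rewrite -bin_gt0 -cards_draws => /card_gt0P[E] /[!inE]/andP[ED /eqP Ek].
by exists E.
Qed.

Lemma cardsU1I (T : finType) (x : T) (u Z : {set T}) :
  x \notin u -> #|(x |: u) :&: Z| = (x \in Z) + #|u :&: Z|.
Proof.
move=> xu; rewrite setIUl; have [xZ|xZ] := boolP (x \in Z).
  by rewrite (setIidPl _) ?sub1set // cardsU1 inE (negPf xu).
by rewrite (_ : [set x] :&: Z = set0) ?set0U //; apply/setP=> y;
  rewrite !inE; case: eqP => // ->; rewrite (negPf xZ).
Qed.

(** * Monotonicity of the number of common neighbours in the intersection size *)

Section LowSets.

Variables (n m : nat).

(** For [A] and [B] of size [2 * m + 1] this is their common neighbourhood in the graph, as a family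
    of plain sets. *)
Definition low_sets (A B : {set 'I_n}) : {set {set 'I_n}} :=
  [set u : {set 'I_n} | [&& #|u| == 2 * m + 1, #|u :&: A| <= m & #|u :&: B| <= m]].

(** A permutation carrying one pair to the other maps low sets injectively to low sets; by symmetry
    this one inequality suffices. *)
Lemma low_sets_eq (A B A' B' : {set 'I_n}) :
  #|A| = #|A'| -> #|B| = #|B'| -> #|A :&: B| = #|A' :&: B'| ->
  #|low_sets A B| = #|low_sets A' B'|.
Proof.
suff le (X Y X' Y' : {set 'I_n}) : #|X| = #|X'| -> #|Y| = #|Y'| -> #|X :&: Y| = #|X' :&: Y'| ->
    #|low_sets X Y| <= #|low_sets X' Y'|.
  by move=> eA eB eAB; apply/eqP; rewrite eqn_leq !le.
move=> eX eY eXY; have [p pP] := perm_pair_of_sets eX eY eXY.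
have imI (u Z Z' : {set 'I_n}) : (forall x, (p x \in Z') = (x \in Z)) ->
    #|p @: u :&: Z'| = #|u :&: Z|.
  move=> pZ; rewrite -(card_imset (mem (u :&: Z)) (@perm_inj _ p)).
  apply: eq_card => x; rewrite -[x](permKV p).
  by rewrite inE !mem_imset ?inE ?pZ //; apply: perm_inj.
rewrite -(card_imset (mem (low_sets X Y)) (imset_inj (@perm_inj _ p))).
apply/subset_leq_card/subsetP=> _ /imsetP[u + ->]; rewrite !inE.
rewrite card_imset; last exact: perm_inj.
by rewrite (imI u X) ?(imI u Y) // => x; case: (pP x).
Qed.

(* The sets lost when [b] is exchanged for [a] in [B] contain [a] but not [b];
   exchanging [a] for [b] in them injects them into the gained ones, and misses
   the gained sets that meet [A] in [m] points. *)
Lemma low_sets_step (A B : {set 'I_n}) (a b : 'I_n) :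
  4 * m + 2 <= n -> #|A| = 2 * m + 1 -> #|B| = 2 * m + 1 -> m <= #|A :&: B| ->
  a \in A :\: B -> b \in B :\: A ->
  #|low_sets A B| < #|low_sets A (a |: B :\ b)|.
Proof.
move=> hn cA cB hI /setDP[aA aB] /setDP[bB bA].
set B' : {set 'I_n} := a |: B :\ b; set P := low_sets A B; set Q := low_sets A B'.
set S := B :\ b.
have ab : a != b by apply: contraNneq bA => <-.
have ba : (b == a) = false by rewrite eq_sym (negPf ab).
have aS : a \notin S by rewrite !inE ab.
have bS : b \notin S by rewrite !inE eqxx.
have EB (u : {set 'I_n}) : #|u :&: B| = (b \in u) + #|u :&: S|.
  by rewrite setIC -(setD1K bB) cardsU1I // [S :&: u]setIC.
have EB' (u : {set 'I_n}) : #|u :&: B'| = (a \in u) + #|u :&: S|.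
  by rewrite setIC cardsU1I // [S :&: u]setIC.
(* Once [P :&: Q] is cancelled, fewer sets must be lost than gained. *)
rewrite -(cardsID Q P) -(cardsID P Q) setIC ltn_add2l.
have PQ (u : {set 'I_n}) : (u \in P :\: Q) = [&& #|u| == 2 * m + 1, #|u :&: A| <= m,
    (b \in u) + #|u :&: S| <= m & m < (a \in u) + #|u :&: S|].
  rewrite !inE EB EB'; case: (#|u| == _) => //; case: (#|u :&: A| <= m) => //=.
  by rewrite -ltnNge andbC.
have QP (u : {set 'I_n}) : (u \in Q :\: P) = [&& #|u| == 2 * m + 1, #|u :&: A| <= m,
    (a \in u) + #|u :&: S| <= m & m < (b \in u) + #|u :&: S|].
  rewrite !inE EB EB'; case: (#|u| == _) => //; case: (#|u :&: A| <= m) => //=.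
  by rewrite -ltnNge andbC.
have lost u : u \in P :\: Q -> a \in u /\ b \notin u.
  rewrite PQ => /and4P[_ _]; case: (a \in u); case: (b \in u) => //=;
    by move: #|u :&: S|; clear; lia.
pose phi (u : {set 'I_n}) := b |: u :\ a.
have phi_inj : {in P :\: Q &, injective phi}.
  have K u : u \in P :\: Q -> a |: phi u :\ b = u.
    by case/lost=> au bu; rewrite setU1K ?setD1K // !inE (negPf bu) andbF.
  by move=> u v uP vP e; rewrite -(K u) // -(K v) // e.
rewrite -(card_in_imset phi_inj); apply: proper_card; apply/properP; split.
  apply/subsetP=> _ /imsetP[u uPQ ->]; have [au bu] := lost u uPQ.
  have bv : b \notin u :\ a by rewrite !inE (negPf bu) andbF.
  have av : a \notin u :\ a by rewrite !inE eqxx.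
  move: uPQ; rewrite -(setD1K au) /phi setU1K //.
  move: (u :\ a) av bv => v av bv.
  rewrite PQ QP !cardsU1I // !cardsU1 !in_setU1 !eqxx aA (negPf bA).
  rewrite (negPf aS) (negPf bS) av bv (negPf av) (negPf bv) ba (negPf ab) /=.
  by rewrite !add0n => /and4P[-> /ltnW-> -> ->].
(* The gained set missed by [phi] is [b |: (T :|: R)], with [m] points [T] in both sets and [m]
   points [R] in neither. Room for [R] exists because the complement of [A :|: B] has
   [n - (4 * m + 2) + #|A :&: B|] points. A preimage would be [a |: (T :|: R)], which meets [A] in
   [m + 1] points. *)
have [T TD cT] := exists_subset_card hI.
have [R RD cR] : exists2 R : {set 'I_n}, R \subset ~: (A :|: B) & #|R| = m.
  by apply: exists_subset_card; rewrite cardsCs setCK card_ord cardsU cA cB;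
    clear -hn hI; lia.
have TA x : x \in T -> (x \in A) && (x \in B) by move/(subsetP TD); rewrite inE.
have RA x : x \in R -> ~~ ((x \in A) || (x \in B)) by move/(subsetP RD); rewrite !inE.
have bTR : b \notin T :|: R.
  rewrite inE negb_or; apply/andP; split; apply/negP.
    by move/TA; rewrite (negPf bA).
  by move/RA; rewrite bB orbT.
have TRA : (T :|: R) :&: A = T.
  apply/setP=> x; rewrite !inE.
  have := TA x; have := RA x; case: (x \in T); case: (x \in R); case: (x \in A);
    case: (x \in B) => //= h1 h2; by [have := h1 isT | have := h2 isT].
have TRS : (T :|: R) :&: S = T.
  apply/setP=> x; rewrite !inE; case: eqP => [->|_] /=.
    by rewrite andbF; apply/esym/negbTE; move: bTR; rewrite inE negb_or => /andP[].
  have := TA x; have := RA x; case: (x \in T); case: (x \in R); case: (x \in A);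
    case: (x \in B) => //= h1 h2; by [have := h1 isT | have := h2 isT].
have TR0 : T :&: R = set0.
  apply/setP=> x; rewrite !inE; apply/negbTE/negP => /andP[/TA/andP[xA _]/RA].
  by rewrite xA.
have aTR : a \notin T :|: R.
  rewrite inE negb_or; apply/andP; split; apply/negP.
    by move/TA; rewrite (negPf aB) andbF.
  by move/RA; rewrite aA.
exists (b |: (T :|: R)).
  have cTR : #|T :|: R| = 2 * m by rewrite cardsU TR0 cards0 cT cR; clear; lia.
  move: (T :|: R) bTR aTR TRA TRS cTR => v bv av vA vS cv.
  rewrite QP !cardsU1I // vA vS cardsU1 bv cv cT.
  rewrite !in_setU1 (negPf av) eqxx (negPf ab) (negPf bA) (negPf bS) /=.
  by apply/and4P; split=> //; clear; lia.
apply/imsetP=> -[u uPQ e]; have [au bu] := lost u uPQ.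
have bv : b \notin u :\ a by rewrite !inE (negPf bu) andbF.
have av : a \notin u :\ a by rewrite !inE eqxx.
have ev : u :\ a = T :|: R by rewrite -(setU1K bv) -/(phi u) -e setU1K.
move: uPQ; rewrite -(setD1K au) ev PQ => /and4P[_ + _ _].
by rewrite cardsU1I // TRA aA cT ltnn.
Qed.

(** Induction on the gap between the intersection sizes: each exchange in [B] raises the
    intersection by one point and the count strictly, until the sizes agree and [low_sets_eq]
    applies. *)
Lemma low_sets_lt (A B A' B' : {set 'I_n}) :
  4 * m + 2 <= n -> #|A| = 2 * m + 1 -> #|B| = 2 * m + 1 ->
  #|A'| = 2 * m + 1 -> #|B'| = 2 * m + 1 ->
  m <= #|A :&: B| -> #|A :&: B| < #|A' :&: B'| ->
  #|low_sets A B| < #|low_sets A' B'|.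
Proof.
move=> hn cA cB cA' cB'; have [d] := ubnP (#|A' :&: B'| - #|A :&: B|).
elim: d B cB => // d IH B cB e hI hlt.
have le : #|A' :&: B'| <= 2 * m + 1 by rewrite -cA' subset_leq_card ?subsetIl.
have [a aAB] : exists a, a \in A :\: B.
  by apply/card_gt0P; rewrite cardsD cA; lia.
have [b bBA] : exists b, b \in B :\: A.
  by apply/card_gt0P; rewrite cardsD cB setIC; lia.
have step := low_sets_step hn cA cB hI aAB bBA.
move/setDP: aAB => [aA aB]; move/setDP: bBA => [bB bA].
set B2 := a |: B :\ b in step.
have aS : a \notin B :\ b by rewrite inE negb_and aB orbT.
have cB2 : #|B2| = 2 * m + 1.
  by rewrite cardsU1 aS -cB (cardsD1 b B) bB.
have cI : #|A :&: B2| = #|A :&: B|.+1.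
  rewrite setIC cardsU1I // aA [A :&: B]setIC.
  by rewrite -[in RHS](setD1K bB) cardsU1I ?(negPf bA) // !inE eqxx.
apply: (leq_trans step); have [eq|ne] := eqVneq #|A :&: B2| #|A' :&: B'|.
  by rewrite (@low_sets_eq A B2 A' B') ?cA ?cB2.
by apply/ltnW/IH => //; move: ne; rewrite cI; lia.
Qed.

End LowSets.

(** * Arithmetic of the reflection identity *)

(** The equation says that [(m + 1) * g] is [(t - (m + 1)) * g1 + (2 * m + 2 - t) * g2], a convex
    combination up to scale; the weight of [g1] is positive exactly when [t] exceeds [m + 1]. *)
Lemma reflection_le (m t g g1 g2 : nat) : m < t -> t <= 2 * m -> g1 < g2 ->
  (2 * m + 2) * (g + g1) = 2 * (t * g1 + (2 * m + 2 - t) * g2) -> g <= g2.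
Proof. nia. Qed.

Lemma reflection_lt (m t g g1 g2 : nat) : m.+1 < t -> t <= 2 * m -> g1 < g2 ->
  (2 * m + 2) * (g + g1) = 2 * (t * g1 + (2 * m + 2 - t) * g2) -> g < g2.
Proof. nia. Qed.

(** Here the equation amounts to [(m + 1) * (g2 - g) = t * (g2 - g1)]. *)
Lemma reflection_lt_big (m t g g1 g2 : nat) : 0 < t -> t <= 2 * m -> g1 < g2 ->
  (2 * m + 2) * (g + g2) = 2 * (t * g1 + (2 * m + 2 - t) * g2) -> g < g2.
Proof. nia. Qed.

(** * The graph, its switching set, and the comparison *)

Section JohnsonSwitching.

Variables (m n : nat).
Hypotheses (hm : 2 <= m) (hn : 4 * m + 2 <= n).

Let k := 2 * m + 1.
Let S : {set 'I_k} := [set s : 'I_k | s <= m].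
Let G : sgraph := J n S.
Let X : {set 'I_n} := [set i : 'I_n | i < 2 * m + 2].
Let C : {set G} := [set A : ksubset n k | val A \subset X].

Lemma cards_valG (A : G) : #|val A| = 2 * m + 1.
Proof. exact/eqP/(valP A). Qed.

Lemma J_adjE (A B : G) : adj G A B = (#|val A :&: val B| <= m).
Proof.
apply/existsP/idP => [[s /andP[]]|h]; first by rewrite inE => sm /eqP->.
have hk : #|val A :&: val B| < k by apply: leq_ltn_trans h _; rewrite /k; lia.
by exists (Ordinal hk); rewrite inE h /=.
Qed.

Lemma common_nbE (A B : G) : common_nb A B = #|low_sets m (val A) (val B)|.
Proof.
rewrite /common_nb -(card_imset _ val_inj); apply: eq_card => u.
apply/imsetP/idP => [[v + ->]|].
  by rewrite !inE !J_adjE ![_ :&: val v]setIC (valP v).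
rewrite inE => /and3P[uk uA uB]; exists (Sub u uk : G); last by rewrite SubK.
by rewrite inE !J_adjE ![_ :&: val (Sub u uk)]setIC !SubK uA.
Qed.

Lemma cardX : #|X| = 2 * m + 2.
Proof.
have h : 2 * m + 2 <= n by lia.
have inj : injective (widen_ord h) by move=> i j /(congr1 val) /= /val_inj.
rewrite -[RHS]card_ord -(card_imset _ inj).
apply: eq_card => i; rewrite inE; apply/idP/imsetP => [ix|[j _ ->]] /=.
  by exists (Ordinal ix) => //; apply: val_inj.
exact: ltn_ord.
Qed.

Lemma C_val (c : G) : c \in C -> exists2 x, x \in X & val c = X :\ x.
Proof.
rewrite inE => cX; have /cards1P[x xE] : #|X :\: val c| == 1.
  by rewrite cardsD (setIidPr cX) cardX cards_valG /k; lia.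
exists x; first by have /setDP[] : x \in X :\: val c by rewrite xE set11.
by rewrite -xE setDDr setDv set0U (setIidPr cX).
Qed.

Lemma card_XD1 (x : 'I_n) : x \in X -> #|X :\ x| == k.
Proof.
move=> xX; have := cardsD1 x X; rewrite cardX xX add1n addn2 => -[<-].
by rewrite /k addn1.
Qed.

(** As [X] has [2 * m + 2] points, each member of [C] is determined by the one point of [X] that it
    omits. *)
Lemma sum_over_C (F : {set 'I_n} -> nat) :
  \sum_(A in C) F (val A) = \sum_(x in X) F (X :\ x).
Proof.
have inj_rem : {in X &, injective (fun x => X :\ x)}.
  move=> x y xX yX /setP/(_ x); rewrite !in_setD1 eqxx xX !andbT.
  by move=> /esym/negbFE/eqP.
rewrite -(big_imset F inj_rem) /= -(big_imset F (in2W val_inj)).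
apply: eq_bigl => A; apply/imsetP/imsetP => [[B BC ->]|[x xX ->]].
  by have [x xX ->] := C_val BC; exists x.
by exists (Sub (X :\ x) (card_XD1 xX) : G); rewrite ?inE SubK ?subD1set.
Qed.

Lemma cardC : #|C| = 2 * m + 2.
Proof. by rewrite -sum1_card (sum_over_C (fun=> 1)) sum1_card cardX. Qed.

Lemma card_meetD1 (x : 'I_n) (U : {set 'I_n}) : x \in X ->
  #|(X :\ x) :&: U| = #|X :&: U| - (x \in U).
Proof.
by move=> xX; rewrite -[in RHS](setD1K xX) cardsU1I ?inE ?eqxx // addKn.
Qed.

Lemma nb_in_J (u : G) : nb_in C u = \sum_(x in X) (#|X :&: val u| - (x \in val u) <= m).
Proof.
have -> : nb_in C u = \sum_(A in C) (#|val A :&: val u| <= m).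
  rewrite /nb_in -sum1_card big_mkcond [RHS]big_mkcond; apply: eq_bigr => A _.
  by rewrite !inE J_adjE setIC; case: (_ \subset _); case: (_ <= m).
rewrite (sum_over_C (fun A => (#|A :&: val u| <= m) : nat)).
by apply: eq_bigr => x xX; rewrite card_meetD1.
Qed.

(** Omitting a point of [X] lowers the intersection with [u] only if that point lies in [u]. So when
    [X] meets [u] in [m.+1] points, the neighbours of [u] in [C] are those omitting one of these
    points. *)
Lemma nb_inE (u : G) : nb_in C u =
  if #|X :&: val u| <= m then 2 * m + 2
  else if #|X :&: val u| == m.+1 then m.+1 else 0.
Proof.
rewrite nb_in_J; set t := #|_|; case: leqP => tm.
  rewrite (eq_bigr (fun=> 1)) ?sum1_card ?cardX // => x _.
  by have -> : t - (x \in val u) <= m by lia.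
case: eqP => tE.
  rewrite (eq_bigr (fun x => (x \in val u) : nat)); last first.
    by move=> x _; rewrite tE; case: (x \in val u) => /=; lia.
  by rewrite -tE /t -sum1_card big_mkcond /= [RHS]big_mkcond; apply: eq_bigr => x _;
    rewrite in_setI; case: (x \in X); case: (x \in val u).
rewrite big1 // => x _; case: (x \in val u) => /=; lia.
Qed.

Lemma meet_in (u : G) : u \in C -> #|X :&: val u| = 2 * m + 1.
Proof. by rewrite inE => /setIidPr ->; apply/eqP/(valP u). Qed.

Lemma meet_out (u : G) : u \notin C -> #|X :&: val u| <= 2 * m.
Proof.
move=> uC; rewrite leqNgt; apply: contra uC => h; rewrite inE.
have/eqP <- : X :&: val u == val u; last exact: subsetIl.
by rewrite eqEcard subsetIr cards_valG addn1.
Qed.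

Lemma nb_in_C (u : G) : u \in C -> nb_in C u = 0.
Proof.
move=> uC; rewrite nb_inE meet_in //.
have -> : (2 * m + 1 <= m) = false by lia.
by have -> : (2 * m + 1 == m.+1) = false by lia.
Qed.

Lemma half_adjacentE (u : G) : half_adjacent C u = (#|X :&: val u| == m.+1).
Proof.
rewrite /half_adjacent cardC nb_inE; move: #|X :&: _| => t.
have -> : 2 * m + 2 = m.+1.*2 by lia.
case: leqP => h; last by case: (t =P m.+1); rewrite ?eqxx ?doubleS.
by apply/eqP/eqP; lia.
Qed.

Lemma switching_set_C : switching_set C.
Proof.
split=> [x y xC yC|u uC]; first by rewrite !nb_in_C.
rewrite half_adjacentE cardC nb_inE; case: leqP => h; first exact: Or33.
by case: eqP => e; [apply: Or32 | apply: Or31].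
Qed.

Let CM := gm_switch C.

Lemma common_nb_lt (A B A' B' : G) :
  m <= #|val A :&: val B| -> #|val A :&: val B| < #|val A' :&: val B'| ->
  common_nb A B < common_nb A' B'.
Proof. by move=> *; rewrite !common_nbE low_sets_lt ?cards_valG. Qed.

Lemma common_nb_eq (A B A' B' : G) :
  #|val A :&: val B| = #|val A' :&: val B'| -> common_nb A B = common_nb A' B'.
Proof. by move=> *; rewrite !common_nbE; apply: low_sets_eq; rewrite ?cards_valG. Qed.

(* With [t = #|X :&: W|], [g1] and [g2] the values of [common_nb _ W] on the
   [t] resp. [2m+2-t] elements of [C] that omit a point of [W] resp. of its
   complement, the reflection identity makes [m.+1 * common_nb c W] in the
   switched graph an affine combination of [g1 < g2]. *)
Lemma common_nb_mixed_lt (c W A B : G) : c \in C -> W \notin C ->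
  ~~ adj CM c W -> #|val A :&: val B| = 2 * m ->
  @common_nb CM c W < common_nb A B.
Proof.
move=> cC WC nadj cAB; set L := common_nb A B.
have [x xX cE] := C_val cC.
have tle := meet_out WC; set t := #|X :&: val W| in tle.
have cW : #|val c :&: val W| = t - (x \in val W) by rewrite cE card_meetD1.
have tX : #|X :\: val W| = 2 * m + 2 - t by rewrite cardsD cardX.
have xt : x \in val W -> 0 < t.
  by move=> xW; apply/card_gt0P; exists x; rewrite inE xX.
(* If [t <= m], then [c] and [W] are adjacent and not switched. If [t = m.+1], they are switched, so
   they were adjacent in [G], which forces [x] into [W]. *)
have [tm xW1] : m < t /\ (t = m.+1 -> x \in val W).
  move: nadj; rewrite gm_adj_mixed // half_adjacentE J_adjE cW -/t.
  move: t tle xt {cW tX} => t tle.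
  by case: (x \in val W) => /= xt; case: eqP => /=; clear -tle xt; lia.
have [x1 /setIP[x1X x1W]] : exists x1, x1 \in X :&: val W.
  by apply/card_gt0P; rewrite -/t; apply: leq_ltn_trans tm.
have [x2 /setDP[x2X x2W]] : exists x2, x2 \in X :\: val W.
  by apply/card_gt0P; rewrite tX subn_gt0 addn2 ltnS leqW.
pose c1 : G := Sub (X :\ x1) (card_XD1 x1X); pose c2 : G := Sub (X :\ x2) (card_XD1 x2X).
have c1W : #|val c1 :&: val W| = t - 1 by rewrite SubK card_meetD1 // x1W.
have c2W : #|val c2 :&: val W| = t by rewrite SubK card_meetD1 // (negPf x2W) subn0.
have lt12 : common_nb c1 W < common_nb c2 W.
  by apply: common_nb_lt; rewrite c1W ?c2W; clear -tm; lia.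
have le2L : common_nb c2 W <= L.
  have [e|ne] := eqVneq t (2 * m); first by rewrite (@common_nb_eq c2 W A B) ?c2W ?cAB.
  by apply/ltnW/common_nb_lt; rewrite c2W ?cAB; [exact: ltnW | rewrite ltn_neqAle ne].
(* Strict because [m + 1 < 2 * m] for [m >= 2]. *)
have lt2L : t = m.+1 -> common_nb c2 W < L.
  by move=> e; apply: common_nb_lt; rewrite c2W ?cAB e; [exact: leqnSn | clear -hm; lia].
have cval : common_nb c W = if x \in val W then common_nb c1 W else common_nb c2 W.
  by case: ifP => xW; apply: common_nb_eq; rewrite cW xW ?c1W ?c2W ?subn0.
have := common_nb_gm_mixed switching_set_C nb_in_C cC WC.
have -> : \sum_(A in C) common_nb A W
    = t * common_nb c1 W + (2 * m + 2 - t) * common_nb c2 W.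
  under eq_bigr => D _ do rewrite common_nbE.
  rewrite (sum_over_C (fun D => #|low_sets m D (val W)|)) (big_setID (val W)) /=.
  congr (_ + _).
    rewrite /t -sum_nat_const; apply: eq_bigr => y /setIP[yX yW].
    rewrite common_nbE; apply: low_sets_eq => //; rewrite ?cards_valG ?(eqP (card_XD1 _)) //.
    by rewrite card_meetD1 // yW c1W.
  rewrite -tX -sum_nat_const; apply: eq_bigr => y /setDP[yX yW].
  rewrite common_nbE; apply: low_sets_eq => //; rewrite ?cards_valG ?(eqP (card_XD1 _)) //.
  by rewrite card_meetD1 // (negPf yW) c2W subn0.
rewrite cardC cval -/CM.
(* At [t = m.+1] the reflection gives only a weak bound by [common_nb c2 W], and [lt2L] supplies
   strictness; in the other cases the reflection bound is itself strict. *)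
move=> e; case: ifP xW1 e => xW xW1 e.
  have [et|ne] := eqVneq t m.+1.
    exact: leq_ltn_trans (reflection_le tm tle lt12 e) (lt2L et).
  have tm1 : m.+1 < t by rewrite ltn_neqAle eq_sym ne.
  exact: leq_trans (reflection_lt tm1 tle lt12 e) le2L.
exact: leq_trans (reflection_lt_big (leq_trans _ tm) tle lt12 e) le2L.
Qed.

Lemma J_not_isomorphic_gm : ~ isomorphic G CM.
Proof.
have m2 : m < 2 * m by clear -hm; lia.
(* Construction of the close pair that switching destroys: [A] and [B] extend the same [E] by a
   point [x] of [X] and by a point [z] outside [X], so they meet in [2 * m] points with only [A] in
   [C]. *)
have [E EX cE] : exists2 E : {set 'I_n}, E \subset X & #|E| = 2 * m.
  by apply: exists_subset_card; rewrite cardX; lia.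
have [z zX] : exists z, z \notin X.
  have /card_gt0P[z] : 0 < #|~: X| by rewrite cardsCs setCK card_ord cardX; lia.
  by rewrite in_setC; exists z.
have [x xXE] : exists x, x \in X :\: E.
  by apply/card_gt0P; rewrite cardsD (setIidPr EX) cardX cE; lia.
have zE : z \notin E by apply: contra zX => /(subsetP EX).
case/setDP: xXE => xX xE.
have cA : #|x |: E| == k by rewrite cardsU1 xE cE /k; lia.
have cB : #|z |: E| == k by rewrite cardsU1 zE cE /k; lia.
pose A : G := Sub (x |: E) cA; pose B : G := Sub (z |: E) cB.
have AC : A \in C by rewrite inE SubK subUset sub1set xX.
have BC : B \notin C.
  by rewrite inE SubK subUset sub1set negb_and zX.
have cAB : #|val A :&: val B| = 2 * m.
  rewrite !SubK cardsU1I // in_setU1 (negPf xE) orbF.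
  have -> : (x == z) = false by apply/negbTE; apply: contraNneq zX => <-.
  by rewrite setIC cardsU1I // (negPf zE) setIid cE.
have AB : A != B by apply: contraNneq BC => <-.
pose L := common_nb A B.
move/(card_close_pairs_iso L)/eqP; apply/negP; rewrite eq_sym neq_ltn.
apply/orP; left; apply: proper_card; apply/properP; split.
  apply/subsetP=> -[u v] /(@close_pairsP CM L u v)[uv nadj le].
  suff [nadj' le'] : ~~ adj G u v /\ L <= @common_nb G u v.
    exact/(@close_pairsP G L u v).
  (* Two members of [C] meet in [2 * m] points, so they are close in [G]; mixed pairs are never
     close in [CM]; outside [C] nothing changes. *)
  have [uC|uC] := boolP (u \in C); have [vC|vC] := boolP (v \in C).
  - have [[y yX uE] [w wX vE]] := (C_val uC, C_val vC).
    have yw : y != w by apply: contraNneq uv => e; apply/eqP/val_inj; rewrite uE vE e.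
    have cuv : #|val u :&: val v| = 2 * m.
      rewrite uE card_meetD1 // meet_in // vE in_setD1 yX yw.
      by rewrite addn1 subn1.
    by rewrite J_adjE cuv -ltnNge (@common_nb_eq u v A B) ?cuv.
  - by have := common_nb_mixed_lt uC vC nadj cAB; rewrite ltnNge le.
  - rewrite (@adj_sym CM) in nadj; rewrite common_nbC in le.
    by have := common_nb_mixed_lt vC uC nadj cAB; rewrite ltnNge le.
  - by rewrite -(@gm_adj_out G C u v) // nadj -(common_nb_gm_out switching_set_C uC vC).
exists (A, B); first by apply/(@close_pairsP G L A B); rewrite AB J_adjE cAB -ltnNge.
apply/(@close_pairsP CM L A B) => -[_ nadj le].
by have := common_nb_mixed_lt AC BC nadj cAB; rewrite ltnNge le.
Qed.

End JohnsonSwitching.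

Theorem theorem3 (m n : nat) (hm : 2 <= m) (hn : 4 * m + 2 <= n) :
  let k := 2 * m + 1 in
  let S : {set 'I_k} := [set s : 'I_k | s <= m] in
  let G : sgraph := J n S in
  let C : {set G} :=
    [set A : ksubset n k | val A \subset [set i : 'I_n | i < 2 * m + 2]] in
  switching_set C /\ ~ isomorphic G (gm_switch C).
Proof.
move=> k S G C; split; [exact: switching_set_C | exact: J_not_isomorphic_gm].
Qed.
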